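(* Consider the band model without upper bounding functions, $\mathscr G_j=\{G_j: g_j\ge g_j^L\}$, $j\in\{0,1\}$. Let $(\hat g_0,\hat g_1)$ be the least favorable densities, and let $A_j=\{y:\hat g_j=g_j^L\}$, $\bar A_j=\Omega\setminus A_j=\{y:\hat g_j>g_j^L\}$. Given that the stationarity conditions $$\frac{\hat g_1}{\hat g_0}=\frac1{k_2}\ \text{ on }\bar A_0,\qquad \frac{\hat g_1}{\hat g_0}=k_1\ \text{ on }\bar A_1$$ hold with positive constants $k_1,k_2$ determined by the normalization constraints, it follows that the least favorable distributions and the corresponding likelihood ratio function are unique and given by $$\hat g_0=\begin{cases}g_0^L,& y\in A_0,\\ k_2g_1^L,& y\in\bar A_0,\end{cases}\qquad \hat g_1=\begin{cases}g_1^L,& y\in A_1,\\ k_1g_0^L,& y\in\bar A_1,\end{cases}$$ and $$\frac{\hat g_1}{\hat g_0}=\begin{cases}\frac1{k_2},& y\in\bar A_0\cap A_1,\\ \frac{g_1^L}{g_0^L},& y\in A_0\cap A_1,\\ k_1,& y\in A_0\cap\bar A_1.\end{cases}$$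
   Context: All densities are with respect to a measure $\mu$ on $\Omega$; $g_j$ is the density of the probability measure $G_j$. The bounding functions $g_0^L,g_1^L$ are non-negative with $\int_\Omega g_j^L\,d\mu\le1$; e.g. $g_j^L=(1-\epsilon_j)f_j$ with nominal densities $f_j$ and $0\le\epsilon_j<1$, in which case $\mathscr G_j=\{(1-\epsilon_j)F_j+\epsilon_jH: H \text{ a probability measure}\}$. Standing assumption for band models: the classes are nonempty and the bounding functions are chosen so that $\mathscr G_0\cap\mathscr G_1=\emptyset$ (so $g_0$ and $g_1$ are always distinct densities). For $u\in(0,1)$ let $D_u(G_0,G_1)=\int_\Omega g_1^ug_0^{1-u}\,d\mu$. The least favorable distributions are the solution of $\min_{u\in(0,1)}\max_{(G_0,G_1)\in\mathscr G_0\times\mathscr G_1}D_u(G_0,G_1)$ (they maximize $D_u$ over $\mathscr G_0\times\mathscr G_1$ for the minimizing $u$). The stationarity conditions in the claim are the first-order Lagrangian conditions of this maximization on the regions where the lower bounds are inactive. *)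

(* Defs.v *)
From HB Require Import structures.
From mathcomp Require Import all_boot all_order all_algebra.
From mathcomp Require Import all_classical all_reals all_analysis.
Set Implicit Arguments.
Unset Strict Implicit.
Unset Printing Implicit Defensive.
Import Order.TTheory GRing.Theory Num.Theory.
Import numFieldNormedType.Exports.
Local Open Scope classical_set_scope.
Local Open Scope ring_scope.

(* [g] is a (nonnegative, real-valued) version of the density of [G] w.r.t. [mu]. *)
Definition is_density (d : measure_display) (T : measurableType d)
    (R : realType) (mu : {measure set T -> \bar R}) (G : probability T R)
    (g : T -> R) : Prop :=
  [/\ measurable_fun setT g,
      (forall x, 0 <= g x) &
      (forall B, measurable B -> G B = (\int[mu]_(x in B) (g x)%:E)%E)].

(* The lower bound is imposed almost everywhere, so that membership does not
   depend on the version of the density. *)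
Definition band (d : measure_display) (T : measurableType d) (R : realType)
    (mu : {measure set T -> \bar R}) (gL : T -> R) : set (probability T R) :=
  [set G | exists2 g, is_density mu G g & {ae mu, forall x, gL x <= g x}].

(* A chosen version of the density of [G]; it is a density of [G] whenever [G]
   has one, and the junk value 0 otherwise. *)
Definition density (d : measure_display) (T : measurableType d) (R : realType)
    (mu : {measure set T -> \bar R}) (G : probability T R) : T -> R :=
  xget (cst 0) [set g | is_density mu G g].

Definition Du (d : measure_display) (T : measurableType d) (R : realType)
    (mu : {measure set T -> \bar R}) (u : R) (G0 G1 : probability T R) :
    \bar R :=
  (\int[mu]_x (density mu G1 x `^ u * density mu G0 x `^ (1 - u))%:E)%E.

Definition supDu (d : measure_display) (T : measurableType d) (R : realType)
    (mu : {measure set T -> \bar R}) (g0L g1L : T -> R) (u : R) : \bar R :=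
  ereal_sup [set Du mu u G.1 G.2 | G in band mu g0L `*` band mu g1L].

(* [(G0, G1)] solves min_(0 < u < 1) max_(H0, H1) D_u(H0, H1): some [u] minimizes
   the inner maximum, which is attained at [(G0, G1)]. *)
Definition least_favorable (d : measure_display) (T : measurableType d)
    (R : realType) (mu : {measure set T -> \bar R}) (g0L g1L : T -> R)
    (G0 G1 : probability T R) : Prop :=
  [/\ band mu g0L G0, band mu g1L G1 &
      exists u : R, [/\ 0 < u < 1,
        (forall v : R, 0 < v < 1 ->
           (supDu mu g0L g1L u <= supDu mu g0L g1L v)%E) &
        Du mu u G0 G1 = supDu mu g0L g1L u]].

(* Main.v *)
Require Import Defs.
From HB Require Import structures.
From mathcomp Require Import all_boot all_order all_algebra.
From mathcomp Require Import all_classical all_reals all_analysis.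
From mathcomp Require Import measurable_realfun ring lra.
Set Implicit Arguments.
Unset Strict Implicit.
Unset Printing Implicit Defensive.
Import Order.TTheory GRing.Theory Num.Theory.
Import numFieldNormedType.Exports.
Local Open Scope classical_set_scope.
Local Open Scope ring_scope.

(* Write [L = g1 / g0].  If [L] exceeded its value [1 / k2] on a set of positive
   measure while the lower bound on [g0] is inactive somewhere, moving a little
   mass of [g0] there would increase [D_u].  So either [g0 = g0L] a.e., or
   [L <= 1 / k2] a.e.; by symmetry either [g1 = g1L] a.e., or [k1 <= L] a.e.
   The two bounds with [k1 = 1 / k2] would give [g0 = g1], which disjointness of
   the bands excludes; hence the two inactive regions do not overlap.
   Conversely these conditions do not involve [u]: by the weighted AM-GM
   inequality they make [(g0, g1)] the unique maximizer of every [D_v],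
   [0 < v < 1].  This gives uniqueness even if another least favorable pair
   is attached to a different minimizing [v]. *)

(** * The integrand of [Du] as a weighted geometric mean, and its tangent planes *)

Definition wgm {R : realType} (v x y : R) : R := x `^ v * y `^ (1 - v).

Section weighted_geometric_mean.
Context {R : realType}.
Implicit Types v c k s x y z g h : R.

Lemma wgm_ge0 v x y : 0 <= wgm v x y.
Proof. by rewrite mulr_ge0 ?powR_ge0. Qed.

Lemma wgmC v x y : wgm (1 - v) y x = wgm v x y.
Proof. by rewrite /wgm subKr mulrC. Qed.

Lemma wgm0l v y : 0 < v -> wgm v 0 y = 0.
Proof. by move=> v0; rewrite /wgm powR0 ?mul0r// gt_eqF. Qed.

Lemma wgm0r v x : v < 1 -> wgm v x 0 = 0.
Proof. by move=> v1; rewrite /wgm powR0 ?mulr0// subr_eq0 gt_eqF. Qed.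

Lemma wgm_scale v c y : 0 < c -> 0 <= y -> wgm v (c * y) y = c `^ v * y.
Proof.
move=> c0; rewrite le_eqVlt => /predU1P[<-|y0].
  (* At [y = 0] the exponent 0 is treated apart, since 0 to the power 0 is 1. *)
  rewrite /wgm !mulr0; have [->|v0] := eqVneq v 0.
    by rewrite subr0 powRr1// mulr0.
  by rewrite powR0// mul0r.
rewrite /wgm powRM ?ltW// -mulrA -powRD; last by rewrite (gt_eqF y0) implybT.
by rewrite subrKC powRr1// ltW.
Qed.

(** The tangent line of exp at [v * s] lies strictly below exp at [s] and at 0; weighting these two
    inequalities by [v] and [1 - v] cancels the linear terms. *)
Lemma expR_convex_lt v s : 0 < v < 1 -> s != 0 ->
  expR (v * s) < v * expR s + (1 - v).
Proof.
move=> /andP[v0 v1] s0.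
have s1 : 1 + (1 - v) * s < expR ((1 - v) * s).
  by rewrite expR_gt1Dx// mulf_neq0// subr_eq0 gt_eqF.
have s2 : 1 + - (v * s) < expR (- (v * s)).
  by rewrite expR_gt1Dx// oppr_eq0 mulf_neq0// gt_eqF.
have -> : expR s = expR ((1 - v) * s) * expR (v * s).
  by rewrite -expRD; congr expR; ring.
have E0 := expR_gt0 (v * s).
have E1 : expR (- (v * s)) * expR (v * s) = 1 by rewrite -expRD addNr expR0.
set E := expR (v * s) in E0 E1 *.
have -> : v * (expR ((1 - v) * s) * E) + (1 - v) =
    (v * expR ((1 - v) * s) + (1 - v) * expR (- (v * s))) * E.
  by rewrite [RHS]mulrDl -!mulrA E1 mulr1.
rewrite -[ltLHS]mul1r ltr_pM2r//.
have : v * (1 + (1 - v) * s) < v * expR ((1 - v) * s) by rewrite ltr_pM2l.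
have : (1 - v) * (1 + - (v * s)) < (1 - v) * expR (- (v * s)).
  by rewrite ltr_pM2l// subr_gt0.
lra.
Qed.

(** The right-hand side is the tangent plane of the concave, 1-homogeneous function [wgm v] along
    the ray [x = c * y]. Writing [x = expR s * (c * y)] reduces the bound and its equality case to
    strict convexity of exp. *)
Lemma wgm_young v c x y : 0 < v < 1 -> 0 < c -> 0 <= x -> 0 <= y ->
  wgm v x y <= v * c `^ (v - 1) * x + (1 - v) * c `^ v * y ?= iff (x == c * y).
Proof.
move=> v01 c0 x0 y0; have /andP[v0 v1] := v01.
have cv1 : c `^ (v - 1) * c = c `^ v by rewrite mulrC mulr_powRB1// ltW.
have C0 : 0 < c `^ (v - 1) by exact: powR_gt0.
have D0 : 0 < c `^ v by exact: powR_gt0.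
have [->|xcy] := eqVneq x (c * y).
  split; rewrite ?wgm_scale//.
    by rewrite mulrA -(mulrA v) cv1 -mulrDl -mulrDl subrKC mul1r.
  by rewrite mulrA -(mulrA v) cv1 -mulrDl -mulrDl subrKC mul1r eqxx.
suff lt : wgm v x y < v * c `^ (v - 1) * x + (1 - v) * c `^ v * y.
  by split; [exact: ltW | rewrite lt_eqF].
move: x0; rewrite le_eqVlt => /predU1P[x0|x0].
  rewrite -x0 wgm0l// mulr0 add0r !mulr_gt0// ?subr_gt0//.
  rewrite lt_neqAle y0 andbT; apply: contra_neq xcy => <-.
  by rewrite mulr0 x0.
move: y0; rewrite le_eqVlt => /predU1P[y0|y0].
  by rewrite -y0 wgm0r// mulr0 addr0 !mulr_gt0.
have cy0 : 0 < c * y by rewrite mulr_gt0.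
pose s := ln (x / (c * y)).
have q0 : 0 < x / (c * y) by rewrite divr_gt0.
have xE : x = expR s * (c * y) by rewrite /s lnK ?posrE// divfK// gt_eqF.
have s0 : s != 0.
  by apply: contra_neq xcy => s0; rewrite xE s0 expR0 mul1r.
have -> : wgm v x y = expR (v * s) * (c `^ v * y).
  rewrite /wgm xE powRM ?expR_ge0 ?ltW// -mulrA -/(wgm v (c * y) y).
  by rewrite wgm_scale ?ltW// [v * s]mulrC expRM.
have -> : v * c `^ (v - 1) * x + (1 - v) * c `^ v * y =
          (v * expR s + (1 - v)) * (c `^ v * y).
  by rewrite xE -cv1; ring.
by rewrite ltr_pM2r ?mulr_gt0// expR_convex_lt.
Qed.

(* Tangent at the right end point: it stays finite when [y = 0]. *)
Lemma wgm_increment v x y z : 0 < v < 1 -> 0 <= x -> 0 <= y -> 0 < z ->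
  (1 - v) * (x / z) `^ v * (z - y) <= wgm v x z - wgm v x y.
Proof.
move=> v01 x0 y0 z0; have /andP[v0 v1] := v01.
move: x0; rewrite le_eqVlt => /predU1P[<-|x0].
  by rewrite mul0r powR0 ?gt_eqF// mulr0 mul0r !wgm0l// subrr.
have [c c0 ->] : exists2 c, 0 < c & x = c * z.
  by exists (x / z); [rewrite divr_gt0 | rewrite divfK// gt_eqF].
have [+ _] := wgm_young v01 c0 (mulr_ge0 (ltW c0) (ltW z0)) y0.
rewrite mulfK ?gt_eqF// wgm_scale ?(ltW z0)//.
rewrite -(mulr_powRB1 (ltW c0) v0); lra.
Qed.

Lemma powRB1_lt v c k : 0 < v < 1 -> 0 < k -> k < c ->
  c `^ (v - 1) < k `^ (v - 1).
Proof.
move=> /andP[v0 v1] k0 kc.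
rewrite -opprB !powRN ltf_pV2 ?posrE ?powR_gt0//; last exact: lt_trans kc.
by rewrite gt0_ltr_powR ?subr_gt0// nnegrE ltW// (lt_trans k0).
Qed.

(** Complementary slackness: the power decreases in [c], so passing to the smaller [k] enlarges a
    nonnegative increment [h - g], while a negative one occurs only for [c = k]. A coefficient that
    varies from point to point thus becomes a constant. *)
Lemma multiplier_le v c k h g : 0 < v < 1 -> 0 < k -> k <= c ->
  (h < g -> c = k) ->
  c `^ (v - 1) * (h - g) <= k `^ (v - 1) * (h - g) ?= iff (c == k) || (h == g).
Proof.
move=> v01 k0; rewrite le_eqVlt => /predU1P[<- _|kc hg].
  by rewrite eqxx; split; rewrite ?lexx ?eqxx.
have kcv := powRB1_lt v01 k0 kc; rewrite gt_eqF//=.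
case: (ltrgtP h g) => [/hg ck|gh|->]; first by rewrite ck ltxx in kc.
- have : c `^ (v - 1) * (h - g) < k `^ (v - 1) * (h - g).
    by rewrite ltr_pM2r// subr_gt0.
  by move=> lt; split; [exact: ltW | rewrite lt_eqF].
- by rewrite subrr !mulr0; split; rewrite ?lexx ?eqxx.
Qed.

End weighted_geometric_mean.

(** * Pointwise domination by a linear form with constant coefficients *)

Section pointwise_domination.
Context {R : realType}.
Implicit Types v k g h : R.

Lemma onem_itv01 v : 0 < v < 1 -> 0 < 1 - v < 1.
Proof. by move=> /andP[v0 v1]; rewrite subr_gt0 v1 gtrBl. Qed.

Lemma leif_pM2l (k x y : R) (C : bool) : 0 < k -> x <= y ?= iff C ->
  k * x <= k * y ?= iff C.
Proof. by move=> k0; rewrite (mono_leif (ler_pM2l k0)). Qed.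

Lemma wgm_increment_young v (c g0 g1 h0 h1 : R) : 0 < v < 1 -> 0 < c ->
  0 <= h1 -> 0 <= h0 -> g1 = c * g0 -> 0 <= g0 ->
  wgm v h1 h0 - wgm v g1 g0 <=
    v * (c `^ (v - 1) * (h1 - g1)) + (1 - v) * (c `^ v * (h0 - g0))
    ?= iff (h1 == c * h0).
Proof.
move=> v01 c0 h10 h00 gc g00.
have g10 : 0 <= g1 by rewrite gc mulr_ge0// ltW.
have [_] := wgm_young v01 c0 g10 g00; rewrite (introT eqP gc) => /eqP ->.
rewrite !mulrBr !mulrA addrACA -opprD /Order.leif lerD2r.
rewrite (inj_eq (addIr _)).
exact: wgm_young.
Qed.

(** Take the tangent plane at [(g1, g0)], whose ratio [c] lies in [[k1, 1 / k2]], and make both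
    coefficients constant by slackness. Equality puts [(h1, h0)] on the same ray; since
    [k1 * k2 < 1], [c] cannot equal both end points, so one coordinate agrees with that of [g] and
    the ray yields the other. *)
Lemma wgm_dominated2 v k1 k2 g0 g1 h0 h1 : 0 < v < 1 ->
  0 < k1 -> 0 < k2 -> k1 * k2 < 1 ->
  0 <= g0 -> 0 <= g1 -> 0 <= h0 -> 0 <= h1 ->
  k1 * g0 <= g1 -> k2 * g1 <= g0 ->
  (h0 < g0 -> g0 = k2 * g1) -> (h1 < g1 -> g1 = k1 * g0) ->
  wgm v h1 h0 - wgm v g1 g0 <=
    v * k1 `^ (v - 1) * (h1 - g1) + (1 - v) * k2 `^ (- v) * (h0 - g0)
    ?= iff ((h1 == g1) && (h0 == g0)).
Proof.
move=> v01 k10 k20 k12 g00 g10 h00 h10 kg1 kg2 H0 H1; have /andP[v0 v1] := v01.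
have [c [c0 gc k1c k2c]] : exists c, [/\ 0 < c, g1 = c * g0, k1 <= c & k2 <= c^-1].
  have [g0E|g0N] := eqVneq g0 0.
    (* Here [k2 * g1 <= g0 = 0] forces [g1 = 0], and any ratio in [[k1, 1 / k2]] would do. *)
    exists k1; split => //; last by rewrite -[leRHS]mul1r ler_pdivlMr// mulrC ltW.
    rewrite g0E mulr0; apply/eqP; rewrite eq_le g10 andbT.
    by rewrite -(pmulr_rle0 _ k20) -g0E.
  have g0p : 0 < g0 by rewrite lt_neqAle eq_sym g0N.
  have k1c : k1 <= g1 / g0 by rewrite ler_pdivlMr.
  have c0 : 0 < g1 / g0 by exact: lt_le_trans k1c.
  exists (g1 / g0); split => //; first by rewrite divfK.
  by rewrite invf_div ler_pdivlMr// (lt_le_trans (mulr_gt0 k10 g0p)).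
have M1 : h1 < g1 -> c = k1.
  move=> hg1; have := H1 hg1; rewrite gc => /mulIf; apply.
  by apply: contraTneq hg1 => g0E; rewrite gc g0E mulr0 -leNgt.
have M0 : h0 < g0 -> c^-1 = k2.
  move=> hg0; have := H0 hg0; rewrite gc mulrA -{1}[g0]mul1r => /mulIf k2E.
  apply: (mulIf (lt0r_neq0 c0)); rewrite mulVf ?lt0r_neq0// k2E//.
  by rewrite gt_eqF// (le_lt_trans h00).
have L1 := leif_pM2l v0 (multiplier_le v01 k10 k1c M1).
(* Same slackness with the two classes exchanged: [v] becomes [1 - v] and [c] becomes its
   inverse. *)
have L0 : (1 - v) * (c `^ v * (h0 - g0)) <= (1 - v) * (k2 `^ (- v) * (h0 - g0))
    ?= iff (c^-1 == k2) || (h0 == g0).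
  have v'0 : 0 < 1 - v by rewrite subr_gt0.
  have := leif_pM2l v'0 (multiplier_le (onem_itv01 v01) k20 k2c M0).
  have -> : 1 - v - 1 = - v by rewrite addrAC subrr add0r.
  by rewrite -{1}powR_inv1 ?(ltW c0)// -powRrM mulN1r opprK.
have := leif_trans (wgm_increment_young v01 c0 h10 h00 gc g00) (leifD L1 L0).
rewrite !mulrA; congr (_ <= _ ?= iff _); apply/idP/idP; last first.
  by move=> /andP[/eqP -> /eqP ->]; rewrite gc !eqxx !orbT.
move=> /andP[/eqP hc /andP[e1 e0]].
case/orP: e1 => [/eqP ck|/eqP hg1]; last first.
  by rewrite hg1 eqxx/= -(inj_eq (mulfI (lt0r_neq0 c0))) -hc -gc hg1.
case/orP: e0 => [/eqP ck2|/eqP hg0]; last by rewrite hc gc hg0 !eqxx.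
by move: k12; rewrite -ck -ck2 divff ?ltxx// gt_eqF.
Qed.

(** Variant for a fixed second argument: only the first one moves, so a lower bound on the ratio
    suffices. *)
Lemma wgm_dominated1 v k g0 g1 h1 : 0 < v < 1 -> 0 < k ->
  0 <= g0 -> 0 <= g1 -> 0 <= h1 -> k * g0 <= g1 ->
  (h1 < g1 -> g1 = k * g0) ->
  wgm v h1 g0 - wgm v g1 g0 <= v * k `^ (v - 1) * (h1 - g1)
    ?= iff (h1 == g1).
Proof.
move=> v01 k0 g00 g10 h10 kg H1; have /andP[v0 v1] := v01.
have [->|hg] := eqVneq h1 g1.
  by rewrite !subrr !mulr0; split; rewrite ?lexx ?eqxx.
suff lt : wgm v h1 g0 - wgm v g1 g0 < v * k `^ (v - 1) * (h1 - g1).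
  by split; [exact: ltW | rewrite lt_eqF].
have pk := powR_gt0 (v - 1) k0.
move: g00; rewrite le_eqVlt => /predU1P[g00|g00].
  rewrite -g00 !wgm0r// subrr !mulr_gt0// subr_gt0 lt_neqAle eq_sym hg/= leNgt.
  by apply: contraL h10 => /[dup] /H1; rewrite -g00 mulr0 => -> ; rewrite ltNge.
have kc : k <= g1 / g0 by rewrite ler_pdivlMr.
have c0 : 0 < g1 / g0 by exact: lt_le_trans kc.
have gc : g1 = g1 / g0 * g0 by rewrite divfK// gt_eqF.
have M1 : h1 < g1 -> g1 / g0 = k.
  by move=> /H1 ->; rewrite mulfK// gt_eqF.
move: kc c0 gc M1; set c := g1 / g0 => kc c0 gc M1.
have := leif_trans (wgm_increment_young v01 c0 h10 (ltW g00) gc (ltW g00))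
  (leifD (leif_pM2l v0 (multiplier_le v01 k0 kc M1)) (conj (lexx _) (eqxx _))).
rewrite subrr !mulr0 !addr0 mulrA => L.
rewrite (lt_leif L); apply: contra hg => /andP[/eqP -> _].
by rewrite -gc.
Qed.

End pointwise_domination.

(** * Almost everywhere comparison of integrals, and the affinity of two densities *)

Section ae_real_integrals.
Context d (T : measurableType d) (R : realType).
Variable mu : {measure set T -> \bar R}.
Implicit Types f g : T -> R.

Lemma ae_ge0_RintegralE f : measurable_fun setT f ->
  {ae mu, forall x, 0 <= f x} ->
  \int[mu]_x f x = \int[mu]_x `|f x|.
Proof.
move=> mf f0; congr fine; apply: ae_eq_integral => //.
- exact/measurable_EFinP.
- by apply/measurable_EFinP; exact: measurableT_comp.
- by apply: filterS f0 => x fx _; rewrite ger0_norm.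
Qed.

Lemma ae_Rintegral_ge0 f : measurable_fun setT f ->
  {ae mu, forall x, 0 <= f x} -> 0 <= \int[mu]_x f x.
Proof. by move=> mf f0; rewrite ae_ge0_RintegralE// Rintegral_ge0. Qed.

Lemma ae_eq0_Rintegral f : mu.-integrable setT (EFin \o f) ->
  {ae mu, forall x, 0 <= f x} -> \int[mu]_x f x <= 0 ->
  {ae mu, forall x, f x = 0}.
Proof.
move=> fi f0 If; have mfE := measurable_int _ fi.
have mf : measurable_fun setT f by exact/measurable_EFinP.
have I0 : (\int[mu]_x `|(f x)%:E| = 0)%E.
  have : \int[mu]_x `|f x| = 0.
    apply/eqP; rewrite eq_le Rintegral_ge0// andbT.
    by rewrite -ae_ge0_RintegralE.
  rewrite /Rintegral => I0; rewrite -[LHS]fineK; first by rewrite I0.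
  by move/integrableP : fi => [_ fi]; rewrite ge0_fin_numE// integral_ge0.
have := (ae_eq_integral_abs mu measurableT mfE).1 I0.
by apply: filterS => x /(_ I)[].
Qed.

Lemma ae_le_eq_Rintegral f g :
  mu.-integrable setT (EFin \o f) -> mu.-integrable setT (EFin \o g) ->
  {ae mu, forall x, f x <= g x} -> \int[mu]_x g x <= \int[mu]_x f x ->
  {ae mu, forall x, g x = f x}.
Proof.
move=> fi gi fg gf.
have : {ae mu, forall x, g x - f x = 0}.
  apply: ae_eq0_Rintegral; first exact: (integrableB measurableT gi fi).
  - by apply: filterS fg => x; rewrite subr_ge0.
  - by rewrite RintegralB// subr_le0.
by apply: filterS => x /eqP; rewrite subr_eq0 => /eqP.
Qed.

Lemma integrable_lincomb a b f g :
  mu.-integrable setT (EFin \o f) -> mu.-integrable setT (EFin \o g) ->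
  mu.-integrable setT (EFin \o (fun x => a * f x + b * g x)).
Proof.
move=> fi gi.
exact: (integrableD measurableT (integrableZl measurableT a fi)
                                (integrableZl measurableT b gi)).
Qed.

Lemma Rintegral_lincomb a b f g :
  mu.-integrable setT (EFin \o f) -> mu.-integrable setT (EFin \o g) ->
  \int[mu]_x (a * f x + b * g x) = a * \int[mu]_x f x + b * \int[mu]_x g x.
Proof.
move=> fi gi; rewrite RintegralD//.
- by rewrite !RintegralZl.
- exact: (integrableZl measurableT a fi).
- exact: (integrableZl measurableT b gi).
Qed.

Definition pdf g := [/\ measurable_fun setT g, (forall x, 0 <= g x) &
  (\int[mu]_x (g x)%:E = 1)%E].

Lemma pdf_integrable g : pdf g -> mu.-integrable setT (EFin \o g).
Proof.
move=> [mg g0 Ig]; apply/integrableP; split; first exact/measurable_EFinP.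
under eq_integral => x _ do rewrite /= ger0_norm//.
by rewrite Ig ltry.
Qed.

Lemma Rintegral_pdf g : pdf g -> \int[mu]_x g x = 1.
Proof. by move=> [_ _ Ig]; rewrite /Rintegral Ig. Qed.

(** Weighted AM-GM ([wgm_young] with [c = 1]) dominates the integrand by [v * f + (1 - v) * g]. *)
Lemma integrable_wgm v f g : 0 < v < 1 -> pdf f -> pdf g ->
  mu.-integrable setT (EFin \o (fun x => wgm v (f x) (g x))).
Proof.
move=> v01 pf pg; have [mf f0 _] := pf; have [mg g0 _] := pg.
apply: le_integrable (integrable_lincomb v (1 - v)
  (pdf_integrable pf) (pdf_integrable pg)) => //.
  apply/measurable_EFinP; apply: measurable_funM;
    exact: measurableT_comp (measurable_powR _) _.
move=> x _; have /andP[v0 v1] := v01.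
rewrite /= lee_fin ger0_norm ?wgm_ge0// ger0_norm; last first.
  by rewrite addr_ge0// mulr_ge0// ?subr_ge0 ltW.
by have [+ _] := wgm_young v01 ltr01 (f0 x) (g0 x); rewrite !powR1 !mulr1.
Qed.

(** The value of [Du] as a real number, on functions instead of measures; [DuE] links the two. *)
Definition affinity v f g : R := \int[mu]_x wgm v (f x) (g x).

Lemma affinityC v f g : affinity (1 - v) g f = affinity v f g.
Proof. by apply: eq_Rintegral => x _; rewrite wgmC. Qed.

(** The linear form integrates to 0 because all four functions have mass 1. An affinity of [h] not
    below that of [g] therefore forces equality almost everywhere in the domination, and its
    equality case identifies the densities. *)
Lemma affinity_dominated_eq v a b g0 g1 h0 h1 : 0 < v < 1 ->
  pdf g0 -> pdf g1 -> pdf h0 -> pdf h1 ->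
  {ae mu, forall x, wgm v (h1 x) (h0 x) - wgm v (g1 x) (g0 x) <=
    a * (h1 x - g1 x) + b * (h0 x - g0 x)
    ?= iff ((h1 x == g1 x) && (h0 x == g0 x))} ->
  affinity v g1 g0 <= affinity v h1 h0 ->
  {ae mu, forall x, h0 x = g0 x /\ h1 x = g1 x}.
Proof.
move=> v01 pg0 pg1 ph0 ph1 dom gh.
have ih := integrable_wgm v01 ph1 ph0; have ig := integrable_wgm v01 pg1 pg0.
have i1 := integrableB measurableT (pdf_integrable ph1) (pdf_integrable pg1).
have i0 := integrableB measurableT (pdf_integrable ph0) (pdf_integrable pg0).
have : {ae mu, forall x, a * (h1 x - g1 x) + b * (h0 x - g0 x) =
                         wgm v (h1 x) (h0 x) - wgm v (g1 x) (g0 x)}.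
  apply: ae_le_eq_Rintegral.
  - exact: (integrableB measurableT ih ig).
  - exact: (integrable_lincomb a b i1 i0).
  - by apply: filterS dom => x [].
  - rewrite RintegralB// Rintegral_lincomb//.
    rewrite !RintegralB ?pdf_integrable//.
    rewrite (Rintegral_pdf pg0) (Rintegral_pdf pg1).
    by rewrite (Rintegral_pdf ph0) (Rintegral_pdf ph1) subrr !mulr0 addr0 subr_ge0.
apply: filterS2 dom => x [_ E] e.
by move: E; rewrite -e eqxx => /esym/andP[/eqP -> /eqP ->].
Qed.

End ae_real_integrals.

(** * The probability measure with a given density *)

Section probability_of_density.
Context d (T : measurableType d) (R : realType).
Variables (mu : {measure set T -> \bar R}) (g : T -> R).
Hypothesis pg : pdf mu g.

Definition pdf_prob (B : set T) : \bar R := (\int[mu]_(x in B) (g x)%:E)%E.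

Let pdf_prob0 : pdf_prob set0 = 0%E.
Proof. exact: integral_set0. Qed.

Let pdf_prob_ge0 B : (0 <= pdf_prob B)%E.
Proof. by apply: integral_ge0 => x _; have [_ g0 _] := pg; rewrite lee_fin. Qed.

Let pdf_prob_sigma_additive : semi_sigma_additive pdf_prob.
Proof.
have [mg g0 _] := pg; move=> /= A mA tA mUA.
rewrite /pdf_prob ge0_integral_bigcup//=; last 2 first.
- by apply: measurable_funTS; exact/measurable_EFinP.
- by move=> x _; rewrite lee_fin.
by apply: is_cvg_ereal_nneg_natsum_cond => n _ _; exact: pdf_prob_ge0.
Qed.

HB.instance Definition _ := isMeasure.Build _ _ _
  pdf_prob pdf_prob0 pdf_prob_ge0 pdf_prob_sigma_additive.

Let pdf_prob_setT : pdf_prob setT = 1%E.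
Proof. by have [] := pg. Qed.

HB.instance Definition _ :=
  @Measure_isProbability.Build _ _ R pdf_prob pdf_prob_setT.

(** Lets a perturbed density compete in [supDu], whose supremum runs over measures. *)
Lemma pdf_is_density : exists G : probability T R, is_density mu G g.
Proof. by exists pdf_prob; have [mg g0 _] := pg; split. Qed.

End probability_of_density.

(** * Passing from measures to versions of their densities *)

Section densities.
Context d (T : measurableType d) (R : realType).
Variable mu : {measure set T -> \bar R}.
Implicit Types (G H : probability T R) (gL g h : T -> R).

Lemma is_density_pdf G g : is_density mu G g -> pdf mu g.
Proof.
by move=> [mg g0 Gg]; split => //; rewrite -Gg// probability_setT.
Qed.

Lemma is_density_unique G g h : is_density mu G g -> is_density mu G h ->
  {ae mu, forall x, g x = h x}.
Proof.
move=> dg dh; have [mg g0 Gg] := dg; have [mh h0 Gh] := dh.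
have : ae_eq mu setT (EFin \o g) (EFin \o h).
  apply: integral_ae_eq => //.
  - exact/pdf_integrable/(is_density_pdf dg).
  - exact/measurable_EFinP.
  - by move=> E _ mE; rewrite -Gg// -Gh.
by apply: filterS => x /(_ I)[].
Qed.

Lemma is_density_ae_eq G H g h : is_density mu G g -> is_density mu H h ->
  {ae mu, forall x, g x = h x} -> forall B, measurable B -> G B = H B.
Proof.
move=> [mg _ Gg] [mh _ Hh] gh B mB; rewrite Gg// Hh//.
apply: ae_eq_integral => //.
- by apply: measurable_funTS; exact/measurable_EFinP.
- by apply: measurable_funTS; exact/measurable_EFinP.
- by apply: filterS gh => x -> _.
Qed.

Lemma density_is_density G g : is_density mu G g ->
  is_density mu G (density mu G).
Proof. by move=> dg; rewrite /density; case: xgetP => // /(_ g). Qed.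

Lemma band_density gL G g : band mu gL G -> is_density mu G g ->
  {ae mu, forall x, gL x <= g x}.
Proof.
move=> [h dh gLh] dg; apply: filterS2 gLh (is_density_unique dh dg) => x.
by move=> ? <-.
Qed.

Lemma band_is_density gL G : band mu gL G -> exists g, is_density mu G g.
Proof. by case=> g dg _; exists g. Qed.

(** [Du] uses chosen versions of the densities; almost everywhere uniqueness lets any versions
    replace them, and integrability makes the value finite. *)
Lemma DuE v G0 G1 g0 g1 : 0 < v < 1 ->
  is_density mu G0 g0 -> is_density mu G1 g1 ->
  Du mu v G0 G1 = (affinity mu v g1 g0)%:E.
Proof.
move=> v01 dg0 dg1; rewrite /Du.
have dd0 := density_is_density dg0; have dd1 := density_is_density dg1.
have ig := integrable_wgm v01 (is_density_pdf dg1) (is_density_pdf dg0).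
have id := integrable_wgm v01 (is_density_pdf dd1) (is_density_pdf dd0).
transitivity (\int[mu]_x (wgm v (g1 x) (g0 x))%:E)%E; last first.
  by rewrite /affinity /Rintegral fineK//; exact: integrable_fin_num ig.
apply: ae_eq_integral => //; [exact: measurable_int id|exact: measurable_int ig|].
apply: filterS2 (is_density_unique dd0 dg0) (is_density_unique dd1 dg1).
by move=> x -> -> _.
Qed.

(** The inner maximization at a fixed exponent, stated on densities. *)
Definition affinity_max v g0L g1L g0 g1 := forall h0 h1, pdf mu h0 -> pdf mu h1 ->
  {ae mu, forall x, g0L x <= h0 x} -> {ae mu, forall x, g1L x <= h1 x} ->
  affinity mu v h1 h0 <= affinity mu v g1 g0.

Lemma affinity_maxC v g0L g1L g0 g1 : affinity_max v g0L g1L g0 g1 ->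
  affinity_max (1 - v) g1L g0L g1 g0.
Proof.
by move=> gmax h0 h1 ph0 ph1 L0 L1; rewrite !affinityC; exact: gmax.
Qed.

Lemma least_favorable_affinity_max g0L g1L G0 G1 g0 g1 :
  least_favorable mu g0L g1L G0 G1 -> is_density mu G0 g0 -> is_density mu G1 g1 ->
  exists2 v, 0 < v < 1 & affinity_max v g0L g1L g0 g1.
Proof.
move=> [b0 b1 [v [v01 _ Dmax]]] dg0 dg1; exists v; [exact: v01 | move=> h0 h1 ph0 ph1 L0 L1].
have [H0 dh0] := pdf_is_density ph0; have [H1 dh1] := pdf_is_density ph1.
rewrite -lee_fin -(DuE v01 dh0 dh1) -(DuE v01 dg0 dg1) Dmax.
by apply: ereal_sup_ubound; exists (H0, H1) => //; split; [exists h0|exists h1].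
Qed.

End densities.

(** * First-order necessary conditions at a maximizer of the affinity *)

Section stationarity.
Context d (T : measurableType d) (R : realType).
Variable mu : {measure set T -> \bar R}.
Implicit Types (gL f g h : T -> R) (v l : R).

Lemma ae_le_pdf_integrable gL g : measurable_fun setT gL ->
  (forall x, 0 <= gL x) -> pdf mu g -> {ae mu, forall x, gL x <= g x} ->
  mu.-integrable setT (EFin \o gL).
Proof.
move=> mgL gL0 [mg g0 Ig] gLg; apply/integrableP; split.
  exact/measurable_EFinP.
under eq_integral => x _ do rewrite /= ger0_norm//.
apply: (@le_lt_trans _ _ 1%E); last exact: ltry.
rewrite -Ig; apply: ae_ge0_le_integral => //.
- by move=> x _; rewrite lee_fin.
- exact/measurable_EFinP.
- by move=> x _; rewrite lee_fin.
- exact/measurable_EFinP.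
- by apply: filterS gLg => x + _; rewrite lee_fin.
Qed.

(* A strict bound fails already with some margin [e > 0], as a countable
   intersection of almost sure events is almost sure. *)
Lemma not_ae_le_margin l f g : (forall x, 0 <= g x) ->
  ~ {ae mu, forall x, f x <= l * g x} ->
  exists2 e, 0 < e & ~ {ae mu, forall x, f x <= (l + e) * g x}.
Proof.
move=> g0; apply: contra_notP => /forall2NP nfg.
have : {ae mu, forall x (n : nat), f x <= (l + n.+1%:R^-1) * g x}.
  apply: ae_foralln => n.
  by have [|/contrapT//] := nfg n.+1%:R^-1; rewrite invr_gt0 ltr0n.
apply: filterS => x fg; have [gx0|gxN] := eqVneq (g x) 0.
  by have := fg 0; rewrite gx0 !mulr0.
have gx : 0 < g x by rewrite lt_neqAle eq_sym gxN g0.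
rewrite -ler_pdivrMr//; apply/ler_addgt0Pr => e e0.
pose n := Num.truncn e^-1.
have ne : n.+1%:R^-1 <= e.
  by rewrite invf_ple ?posrE ?ltr0n// ltW// truncnS_gt.
have := fg n; rewrite -ler_pdivrMr// => /le_trans; apply.
by rewrite lerD2l.
Qed.

(* Pointwise effect of moving mass of [g] from where [f = l g] to where
   [f > (l + e) g]; [w] is the profile of the added mass. *)
Lemma wgm_shift_ge (v l e c t f g gL w : R) : 0 < v < 1 -> 0 < l -> 0 < e ->
  0 < c -> 0 < t < 1 -> 0 <= f -> 0 <= g -> 0 <= gL -> gL <= g ->
  (g != gL -> f = l * g) ->
  w = (if (l + e) * g < f then f else 0) ->
  (1 - v) * t * (c * ((l + e)^-1 + t * c)^-1 `^ v * w
                 - (l / (1 - t)) `^ v * (g - gL)) <=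
  wgm v f ((1 - t) * g + t * (gL + c * w)) - wgm v f g.
Proof.
move=> v01 l0 e0 c0 /andP[t0 t1] f0 g0 gL0 gLg st ->.
have /andP[v0 v1] := v01.
have le0 : 0 < l + e by lra.
have [gE|gN] := eqVneq g gL; last first.
  have fE := st gN; have glt : gL < g by rewrite lt_neqAle eq_sym gN.
  have gp : 0 < g by exact: le_lt_trans glt.
  have -> : (l + e) * g < f = false.
    by rewrite fE; apply/negbTE; rewrite -leNgt ler_pM2r// lerDl ltW.
  rewrite /= !mulr0 addr0 sub0r.
  (* Donor point: [f = l * g], so it receives nothing. The new value keeps at least [(1 - t) * g],
     hence [f / z <= l / (1 - t)]. *)
  set z := (1 - t) * g + t * gL.
  have z0 : (1 - t) * g <= z by rewrite /z lerDl mulr_ge0// ltW.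
  have z0' : 0 < z by apply: lt_le_trans z0; rewrite mulr_gt0// subr_gt0.
  apply: le_trans (wgm_increment v01 f0 g0 z0').
  have zg : z - g = - (t * (g - gL)) by rewrite /z; ring.
  rewrite zg; have fz : f / z <= l / (1 - t).
    rewrite ler_pdivrMr// mulrAC ler_pdivlMr ?subr_gt0// fE -mulrA.
    by rewrite ler_pM2l// mulrC.
  have P : (f / z) `^ v <= (l / (1 - t)) `^ v.
    apply: (ge0_ler_powR (ltW v0)) fz; rewrite nnegrE.
      by rewrite divr_ge0// ltW.
    by rewrite divr_ge0 ?(ltW l0)// subr_ge0 ltW.
  have : ((1 - v) * t * (g - gL)) * (f / z) `^ v <=
         ((1 - v) * t * (g - gL)) * (l / (1 - t)) `^ v.
    by rewrite ler_wpM2l// !mulr_ge0// ?subr_ge0// ltW.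
  lra.
rewrite -gE subrr mulr0 subr0; case: ifPn => [fg|_]; last first.
  by rewrite !mulr0 addr0 -mulrDl subrK mul1r subrr.
(* Receiving point: [g] is below [f / (l + e)] and [t * c * f] is added, which bounds [z / f] from
   above. *)
set z := (1 - t) * g + _; have zE : z = g + t * c * f by rewrite /z; ring.
have fp : 0 < f by apply: le_lt_trans fg; rewrite mulr_ge0// ltW.
have b0 : 0 < (l + e)^-1 + t * c by rewrite addr_gt0 ?invr_gt0 ?mulr_gt0.
have z0 : 0 < z by rewrite zE ltr_wpDl// !mulr_gt0.
apply: le_trans (wgm_increment v01 f0 g0 z0).
have zg : z - g = t * c * f by rewrite zE; ring.
have fz : ((l + e)^-1 + t * c)^-1 <= f / z.
  rewrite ler_pdivlMr// mulrC ler_pdivrMr// zE mulrDr lerD//.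
    by rewrite ler_pdivlMr// mulrC ltW.
  by rewrite mulrC.
have P : ((l + e)^-1 + t * c)^-1 `^ v <= (f / z) `^ v.
  apply: (ge0_ler_powR (ltW v0)) fz; rewrite nnegrE.
    by rewrite invr_ge0 ltW.
  by rewrite divr_ge0// ltW.
have : ((1 - v) * (t * c * f)) * ((l + e)^-1 + t * c)^-1 `^ v <=
       ((1 - v) * (t * c * f)) * (f / z) `^ v.
  by rewrite ler_wpM2l// !mulr_ge0// ?subr_ge0// ltW.
rewrite zg; lra.
Qed.

(* If neither alternative held, moving a little mass of [g] towards the points
   where [f / g > l] would increase the affinity. *)
Lemma affinity_max_stationary v l gL f g : 0 < v < 1 -> 0 < l ->
  measurable_fun setT gL -> (forall x, 0 <= gL x) -> pdf mu f -> pdf mu g ->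
  {ae mu, forall x, gL x <= g x} ->
  {ae mu, forall x, g x != gL x -> f x = l * g x} ->
  (forall h, pdf mu h -> {ae mu, forall x, gL x <= h x} ->
    affinity mu v f h <= affinity mu v f g) ->
  {ae mu, forall x, g x = gL x} \/ {ae mu, forall x, f x <= l * g x}.
Proof.
move=> v01 l0 mgL gL0 pf pg gLg st gmax; have /andP[v0 v1] := v01.
have [mf f0 _] := pf; have [mg g0 _] := pg.
apply: contrapT => /not_orP[ngL /(not_ae_le_margin g0)[e e0 nfg]].
have le0 : 0 < l + e by lra.
have igL := ae_le_pdf_integrable mgL gL0 pg gLg.
have ig := pdf_integrable pg; have if_ := pdf_integrable pf.
(* Cutting off [f], rather than taking an indicator, keeps the profile integrable even if the set
   has infinite measure. *)
pose w x := if (l + e) * g x < f x then f x else 0.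
have w0 x : 0 <= w x by rewrite /w; case: ifP.
have mw : measurable_fun setT w.
  apply: measurable_fun_ifT => //; apply: measurable_fun_ltr => //.
  exact: measurable_funM.
have iw : mu.-integrable setT (EFin \o w).
  apply: le_integrable if_ => //; first exact/measurable_EFinP.
  move=> x _; rewrite /= lee_fin !ger0_norm//.
  by rewrite /w; case: ifP.
have igg := integrableB measurableT ig igL.
pose m := \int[mu]_x (g x - gL x).
pose s := \int[mu]_x w x.
have m0 : 0 < m.
  rewrite ltNge; apply/negP => m0; apply: ngL.
  have : {ae mu, forall x, g x - gL x = 0}.
    apply: ae_eq0_Rintegral igg _ m0.
    by apply: filterS gLg => x; rewrite subr_ge0.
  by apply: filterS => x /eqP; rewrite subr_eq0 => /eqP.
have s0 : 0 < s.
  rewrite ltNge; apply/negP => s0; apply: nfg.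
  have := ae_eq0_Rintegral iw (aeW mu w0) s0.
  apply: filterS => x; rewrite /w; case: ltP => // fg fx0; move: fg.
  by rewrite fx0 ltNge mulr_ge0// ltW.
(* With this [c], [gL + c * w] has mass [(1 - m) + m = 1], so its mixture [q] with [g] is again an
   admissible density. *)
have [c c0 cs] : exists2 c, 0 < c & c * s = m.
  by exists (m / s); [rewrite divr_gt0 | rewrite divfK// gt_eqF].
have lc0 : 0 < 1 + l * c by rewrite addr_gt0// mulr_gt0.
(* The gain exceeds the loss ([A < B] below) when [t * (1 + l * c) < 1 - l / (l + e)]; [t] is half
   of this threshold. *)
have [t t0 tE] : exists2 t, 0 < t & t * (1 + l * c) * 2 = 1 - l / (l + e).
  exists (e / (l + e) / (1 + l * c) / 2); first by rewrite !divr_gt0.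
  rewrite mulrAC divfK ?pnatr_eq0// divfK ?gt_eqF//.
  by apply: (mulIf (lt0r_neq0 le0)); rewrite mulrBl !divfK ?gt_eqF//; ring.
have ll : 0 < l / (l + e) by rewrite divr_gt0.
have tlc : 0 < t * (l * c) by rewrite !mulr_gt0.
have t1 : t < 1 by lra.
have t01 : 0 < t < 1 by rewrite t0.
pose q x := (1 - t) * g x + t * (gL x + c * w x).
have icw := integrable_lincomb 1 c igL iw.
have qE x : q x = (1 - t) * g x + t * (1 * gL x + c * w x) by rewrite mul1r.
have q0 x : 0 <= q x.
  apply: addr_ge0; apply: mulr_ge0 => //; [by rewrite subr_ge0 ltW|exact: ltW|].
  by rewrite addr_ge0// mulr_ge0// ltW.
have mq : measurable_fun setT q.
  apply: measurable_funD; apply: measurable_funM => //.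
  by apply: measurable_funD => //; exact: measurable_funM.
have gLE : \int[mu]_x gL x = 1 - m.
  by rewrite /m RintegralB// (Rintegral_pdf pg) subKr.
have pq : pdf mu q.
  split => //.
  have iq : mu.-integrable setT (EFin \o q).
    have := integrable_lincomb (1 - t) t ig icw.
    by apply: eq_integrable => // x _; rewrite /= qE.
  rewrite -[LHS]fineK; last exact: integrable_fin_num iq.
  congr EFin.
  transitivity (\int[mu]_x ((1 - t) * g x + t * (1 * gL x + c * w x))).
    by apply: eq_Rintegral => x _; exact: qE.
  rewrite Rintegral_lincomb// Rintegral_lincomb// (Rintegral_pdf pg) gLE -/s.
  by rewrite cs; ring.
have gLq : {ae mu, forall x, gL x <= q x}.
  apply: filterS gLg => x gLgx.
  have : (1 - t) * gL x <= (1 - t) * g x by rewrite ler_wpM2l// subr_ge0 ltW.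
  have : 0 <= t * (c * w x) by rewrite !mulr_ge0// ltW.
  rewrite /q; lra.
have := gmax q pq gLq; apply/negP; rewrite -ltNge -subr_gt0.
rewrite /affinity.
have iwq := integrable_wgm v01 pf pq; have iwg := integrable_wgm v01 pf pg.
rewrite -RintegralB//.
pose B := ((l + e)^-1 + t * c)^-1 `^ v; pose A := (l / (1 - t)) `^ v.
have AB : A < B.
  have b0 : 0 < (l + e)^-1 + t * c by rewrite addr_gt0 ?invr_gt0 ?mulr_gt0.
  apply: gt0_ltr_powR => //.
  - by rewrite nnegrE divr_ge0 ?subr_ge0// ltW.
  - by rewrite nnegrE invr_ge0 ltW.
  rewrite ltr_pdivrMr ?subr_gt0// mulrC ltr_pdivlMr// mulrDr.
  lra.
have ilow := integrable_lincomb ((1 - v) * t * (c * B)) (- ((1 - v) * t * A)) iw igg.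
(* The minorant from [wgm_shift_ge] has integral [(1 - v) * t * m * (B - A)], as donated and
   received mass are both [m] before the factor [t]. *)
apply: (@lt_le_trans _ _ (\int[mu]_x ((1 - v) * t * (c * B) * w x
           + - ((1 - v) * t * A) * (g x - gL x)))).
  rewrite Rintegral_lincomb// -/s -/m.
  have -> : (1 - v) * t * (c * B) * s + - ((1 - v) * t * A) * m =
            (1 - v) * t * m * (B - A).
    by rewrite -cs; ring.
  by rewrite !mulr_gt0 ?subr_gt0.
rewrite -subr_ge0 -RintegralB//; last exact: (integrableB measurableT iwq iwg).
apply: ae_Rintegral_ge0.
  apply/measurable_EFinP.
  apply: measurable_int (integrableB measurableT (integrableB measurableT iwq iwg) ilow).
apply: filterS2 gLg st => x gLgx stx; rewrite subr_ge0.
have := wgm_shift_ge v01 l0 e0 c0 t01 (f0 x) (g0 x) (gL0 x) gLgx stx (erefl (w x)).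
by rewrite -/A -/B; apply: le_trans; rewrite le_eqVlt; apply/orP; left; apply/eqP; ring.
Qed.

End stationarity.

(** * Uniqueness of the maximizer from bounds on the likelihood ratio *)

Section clipped_likelihood_ratio.
Context d (T : measurableType d) (R : realType).
Variable mu : {measure set T -> \bar R}.
Implicit Types (g h : T -> R) (v k : R).

Lemma pdf_ae_le_eq g h : pdf mu g -> pdf mu h ->
  {ae mu, forall x, g x <= h x} -> {ae mu, forall x, h x = g x}.
Proof.
move=> pg ph gh; apply: ae_le_eq_Rintegral; [exact: pdf_integrable..|by []|].
by rewrite (Rintegral_pdf pg) (Rintegral_pdf ph).
Qed.

Lemma pdf_scale_le1 k g h : 0 < k -> pdf mu g -> pdf mu h ->
  {ae mu, forall x, k * g x <= h x} -> k <= 1.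
Proof.
move=> k0 pg ph gh.
have ig := pdf_integrable pg; have ih := pdf_integrable ph.
have [mg _ _] := pg; have [mh _ _] := ph.
have : 0 <= \int[mu]_x (1 * h x + - k * g x).
  apply: ae_Rintegral_ge0.
    by apply: measurable_funD; exact: measurable_funM.
  by apply: filterS gh => x; rewrite mul1r mulNr subr_ge0.
by rewrite Rintegral_lincomb// (Rintegral_pdf pg) (Rintegral_pdf ph); lra.
Qed.

(** Comparing masses gives [k1 <= 1] and [k2 <= 1]. A product of at least 1 would force [k2 = 1],
    hence [g1 <= g0] with equal masses, so the densities would coincide. *)
Lemma pdf_ratio_bounds_lt1 k1 k2 g0 g1 : 0 < k1 -> 0 < k2 ->
  pdf mu g0 -> pdf mu g1 -> ~ {ae mu, forall x, g0 x = g1 x} ->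
  {ae mu, forall x, k1 * g0 x <= g1 x} ->
  {ae mu, forall x, k2 * g1 x <= g0 x} -> k1 * k2 < 1.
Proof.
move=> k10 k20 pg0 pg1 g01 le1 le2.
have k11 := pdf_scale_le1 k10 pg0 pg1 le1.
have k21 := pdf_scale_le1 k20 pg1 pg0 le2.
rewrite ltNge; apply/negP => k12; apply: g01.
have kE : k2 = 1 by nra.
rewrite kE in le2; apply: (pdf_ae_le_eq pg1 pg0).
by apply: filterS le2 => x; rewrite mul1r.
Qed.

(** Case of one forced coordinate: it contributes no increment, so its multiplier is taken to be
    0. *)
Lemma affinity_unique1 v k gL g0 g1 h0 h1 : 0 < v < 1 -> 0 < k ->
  pdf mu g0 -> pdf mu g1 -> pdf mu h0 -> pdf mu h1 ->
  {ae mu, forall x, gL x <= h1 x} -> {ae mu, forall x, h0 x = g0 x} ->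
  {ae mu, forall x, g1 x != gL x -> g1 x = k * g0 x} ->
  {ae mu, forall x, k * g0 x <= g1 x} ->
  affinity mu v g1 g0 <= affinity mu v h1 h0 ->
  {ae mu, forall x, h0 x = g0 x /\ h1 x = g1 x}.
Proof.
move=> v01 k0 pg0 pg1 ph0 ph1 gLh hg0 st kg aff.
have [_ g00 _] := pg0; have [_ g10 _] := pg1; have [_ h10 _] := ph1.
apply: (@affinity_dominated_eq _ _ _ mu v (v * k `^ (v - 1)) 0 g0 g1 h0 h1) => //.
apply: filterS2 (filterI gLh hg0) (filterI st kg) => x [gLx ->] [stx kgx].
rewrite subrr mulr0 addr0 eqxx andbT; apply: wgm_dominated1 => // hg.
by apply: stx; rewrite gt_eqF// (le_lt_trans gLx).
Qed.

Lemma affinity_unique v k1 k2 g0L g1L g0 g1 h0 h1 :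
  0 < v < 1 -> 0 < k1 -> 0 < k2 ->
  pdf mu g0 -> pdf mu g1 -> pdf mu h0 -> pdf mu h1 ->
  ~ {ae mu, forall x, g0 x = g1 x} ->
  {ae mu, forall x, g0L x <= h0 x} -> {ae mu, forall x, g1L x <= h1 x} ->
  {ae mu, forall x, g0 x != g0L x -> g0 x = k2 * g1 x} ->
  {ae mu, forall x, g1 x != g1L x -> g1 x = k1 * g0 x} ->
  {ae mu, forall x, g0 x = g0L x} \/ {ae mu, forall x, k2 * g1 x <= g0 x} ->
  {ae mu, forall x, g1 x = g1L x} \/ {ae mu, forall x, k1 * g0 x <= g1 x} ->
  affinity mu v g1 g0 <= affinity mu v h1 h0 ->
  {ae mu, forall x, h0 x = g0 x /\ h1 x = g1 x}.
Proof.
move=> v01 k10 k20 pg0 pg1 ph0 ph1 g01 L0 L1 st0 st1 K0 K1 aff.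
(* A density equal to its lower bound gives that bound mass 1, leaving no room for another density
   above it. *)
have attained g h gL : pdf mu g -> pdf mu h -> {ae mu, forall x, gL x <= h x} ->
    {ae mu, forall x, g x = gL x} -> {ae mu, forall x, h x = g x}.
  move=> pg ph gLh gE; apply: pdf_ae_le_eq => //.
  by apply: filterS2 gLh gE => x gLx ->.
case: K0 => [/(attained _ _ _ pg0 ph0 L0) E0|K0].
  case: K1 => [/(attained _ _ _ pg1 ph1 L1) E1|K1].
    by apply: filterS2 E0 E1.
  exact: (affinity_unique1 v01 k10 pg0 pg1 ph0 ph1 L1 E0 st1 K1 aff).
case: K1 => [/(attained _ _ _ pg1 ph1 L1) E1|K1].
  (* Mirror image of the preceding case, with the classes exchanged through [affinityC]. *)
  have v'01 := onem_itv01 v01.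
  rewrite -(affinityC _ v) -(affinityC _ v h1) in aff.
  have := affinity_unique1 v'01 k20 pg1 pg0 ph1 ph0 L0 E1 st0 K0 aff.
  by apply: filterS => x [].
have k12 := pdf_ratio_bounds_lt1 k10 k20 pg0 pg1 g01 K1 K0.
apply: (@affinity_dominated_eq _ _ _ mu v (v * k1 `^ (v - 1))
  ((1 - v) * k2 `^ (- v)) g0 g1 h0 h1) => //.
have [_ g00 _] := pg0; have [_ g10 _] := pg1.
have [_ h00 _] := ph0; have [_ h10 _] := ph1.
apply: filterS2 (filterI (filterI L0 L1) (filterI st0 st1)) (filterI K0 K1).
move=> x [[L0x L1x] [st0x st1x]] [K0x K1x].
apply: (wgm_dominated2 v01 k10 k20 k12) => // hg.
- by apply: st0x; rewrite gt_eqF// (le_lt_trans L0x).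
- by apply: st1x; rewrite gt_eqF// (le_lt_trans L1x).
Qed.

End clipped_likelihood_ratio.

(** * Explicit form and uniqueness of the least favorable densities *)

Theorem mainTheorem4 (d : measure_display) (T : measurableType d)
    (R : realType) (mu : {measure set T -> \bar R}) (g0L g1L : T -> R)
    (mg0L : measurable_fun setT g0L) (mg1L : measurable_fun setT g1L)
    (g0L_ge0 : forall y, 0 <= g0L y) (g1L_ge0 : forall y, 0 <= g1L y)
    (g0L_le1 : (\int[mu]_y (g0L y)%:E <= 1)%E)
    (g1L_le1 : (\int[mu]_y (g1L y)%:E <= 1)%E)
    (band0 : band mu g0L !=set0) (band1 : band mu g1L !=set0)
    (disj : band mu g0L `&` band mu g1L = set0)
    (G0 G1 : probability T R) (lfd : least_favorable mu g0L g1L G0 G1)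
    (g0 g1 : T -> R) (dg0 : is_density mu G0 g0) (dg1 : is_density mu G1 g1)
    (k1 k2 : R) (k1_gt0 : 0 < k1) (k2_gt0 : 0 < k2) :
  let A0 := [set y | g0 y = g0L y] in
  let A1 := [set y | g1 y = g1L y] in
  {ae mu, forall y, (~` A0) y -> g1 y / g0 y = 1 / k2} ->
  {ae mu, forall y, (~` A1) y -> g1 y / g0 y = k1} ->
  [/\ (* uniqueness of the distributions, densities and likelihood ratio *)
      (forall H0 H1 : probability T R, least_favorable mu g0L g1L H0 H1 ->
         (forall B, measurable B -> H0 B = G0 B /\ H1 B = G1 B) /\
         (forall h0 h1 : T -> R, is_density mu H0 h0 -> is_density mu H1 h1 ->
            {ae mu, forall y, [/\ h0 y = g0 y, h1 y = g1 y &
                                  h1 y / h0 y = g1 y / g0 y]})),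
      {ae mu, forall y, (A0 y -> g0 y = g0L y) /\
                        ((~` A0) y -> g0 y = k2 * g1L y)},
      {ae mu, forall y, (A1 y -> g1 y = g1L y) /\
                        ((~` A1) y -> g1 y = k1 * g0L y)} &
      {ae mu, forall y,
         [\/ (~` A0 `&` A1) y /\ g1 y / g0 y = 1 / k2,
             (A0 `&` A1) y /\ g1 y / g0 y = g1L y / g0L y |
             (A0 `&` ~` A1) y /\ g1 y / g0 y = k1]}].
Proof.
move=> A0 A1 ratio0 ratio1.
have pg0 := is_density_pdf dg0; have pg1 := is_density_pdf dg1.
have [_ g0_ge0 _] := dg0; have [_ g1_ge0 _] := dg1.
have [b0 b1 _] := lfd.
have L0 := band_density b0 dg0; have L1 := band_density b1 dg1.
have st0 : {ae mu, forall x, g0 x != g0L x -> g0 x = k2 * g1 x}.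
  apply: filterS2 ratio0 L0 => x r0 L0x gN.
  (* Off [A0], [g0] exceeds the nonnegative [g0L], so the quotient is genuine. *)
  have g0x : g0 x != 0.
    by rewrite gt_eqF// (le_lt_trans (g0L_ge0 x))// lt_neqAle eq_sym gN.
  have /r0 r0x : (~` A0) x by apply/eqP.
  by rewrite -[g1 x](divfK g0x) r0x mulrA mulrC div1r mulfV ?mulr1// gt_eqF.
have st1 : {ae mu, forall x, g1 x != g1L x -> g1 x = k1 * g0 x}.
  apply: filterS ratio1 => x r1 gN.
  have /r1 r1x : (~` A1) x by apply/eqP.
  (* Division by 0 returns 0, so a ratio equal to [k1 > 0] excludes [g0 x = 0]. *)
  have g0x : g0 x != 0.
    by apply: contraTneq k1_gt0 => g0x; rewrite -r1x g0x invr0 mulr0 ltxx.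
  by rewrite -r1x divfK.
have neq : ~ {ae mu, forall x, g0 x = g1 x}.
  move=> g01; have : (band mu g0L `&` band mu g1L) G0.
    split=> //; exists g0 => //.
    by apply: filterS2 L1 g01 => x L1x ->.
  by rewrite disj.
have [u u01 gmax] := least_favorable_affinity_max lfd dg0 dg1.
have u'01 := onem_itv01 u01.
have K0 : {ae mu, forall x, g0 x = g0L x} \/ {ae mu, forall x, k2 * g1 x <= g0 x}.
  have st : {ae mu, forall x, g0 x != g0L x -> g1 x = k2^-1 * g0 x}.
    by apply: filterS st0 => x stx /stx ->; rewrite mulrA mulVf ?mul1r// gt_eqF.
  have ik2 : 0 < k2^-1 by rewrite invr_gt0.
  have [|E|H] := affinity_max_stationary u01 ik2 mg0L g0L_ge0 pg1 pg0 L0 st.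
  - by move=> h ph Lh; exact: gmax.
  - by left.
  - by right; apply: filterS H => x; rewrite mulrC ler_pdivlMr// mulrC.
have K1 : {ae mu, forall x, g1 x = g1L x} \/ {ae mu, forall x, k1 * g0 x <= g1 x}.
  have st : {ae mu, forall x, g1 x != g1L x -> g0 x = k1^-1 * g1 x}.
    by apply: filterS st1 => x stx /stx ->; rewrite mulrA mulVf ?mul1r// gt_eqF.
  have ik1 : 0 < k1^-1 by rewrite invr_gt0.
  have [|E|H] := affinity_max_stationary u'01 ik1 mg1L g1L_ge0 pg0 pg1 L1 st.
  - by move=> h ph Lh; exact: (affinity_maxC gmax).
  - by left.
  - by right; apply: filterS H => x; rewrite mulrC ler_pdivlMr// mulrC.
(* If neither density equals its bound almost everywhere, then [k1 * k2 < 1]; a common inactive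
   point would give [g0 x = k2 * k1 * g0 x] with [g0 x > 0]. *)
have overlap0 : {ae mu, forall x, A0 x \/ A1 x}.
  case: K0 => [K0|K0]; first by apply: filterS K0 => x; left.
  case: K1 => [K1|K1]; first by apply: filterS K1 => x; right.
  have k12 := pdf_ratio_bounds_lt1 k1_gt0 k2_gt0 pg0 pg1 neq K1 K0.
  apply: filterS2 L0 (filterI st0 st1) => x L0x [st0x st1x].
  have [/eqP|g0N] := boolP (g0 x == g0L x); first by left.
  have [/eqP|g1N] := boolP (g1 x == g1L x); first by right.
  have g0x : 0 < g0 x.
    by rewrite (le_lt_trans (g0L_ge0 x))// lt_neqAle eq_sym g0N.
  have := st0x g0N; rewrite (st1x g1N) mulrA => g0E.
  by move: k12; rewrite -(ltr_pM2r g0x) mul1r (mulrC k1) -g0E ltxx.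
split.
- move=> H0 H1 Hlf; have [bH0 bH1 _] := Hlf.
  have uniq h0 h1 : is_density mu H0 h0 -> is_density mu H1 h1 ->
      {ae mu, forall x, h0 x = g0 x /\ h1 x = g1 x}.
    move=> dh0 dh1.
    (* The other pair is maximal at its own exponent [v], so there its affinity is not below that of
       [(g0, g1)]; the conditions on [(g0, g1)] obtained at [u] are then used at [v]. *)
    have [v v01 hmax] := least_favorable_affinity_max Hlf dh0 dh1.
    apply: (affinity_unique v01 k1_gt0 k2_gt0 pg0 pg1 (is_density_pdf dh0)
      (is_density_pdf dh1) neq (band_density bH0 dh0) (band_density bH1 dh1)
      st0 st1 K0 K1).
    exact: hmax.
  split=> [B mB|h0 h1 dh0 dh1]; last first.
    by apply: filterS (uniq h0 h1 dh0 dh1) => x [-> ->].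
  have [h0 dh0] := band_is_density bH0; have [h1 dh1] := band_is_density bH1.
  split; [apply: (is_density_ae_eq dh0 dg0) => //|
          apply: (is_density_ae_eq dh1 dg1) => //];
    by apply: filterS (uniq h0 h1 dh0 dh1) => x [].
- apply: filterS2 overlap0 st0 => x A01 st0x; split=> // nA0.
  (* Off [A0] the bound on [g1] is active, so [k2 * g1] is [k2 * g1L]. *)
  by case: A01 => // A1x; rewrite -A1x; apply: st0x; apply/eqP.
- apply: filterS2 overlap0 st1 => x A01 st1x; split=> // nA1.
  by case: A01 => // A0x; rewrite -A0x; apply: st1x; apply/eqP.
- apply: filterS2 overlap0 (filterI ratio0 ratio1) => x A01 [r0 r1].
  have [A0x|nA0] := pselect (A0 x); last first.
    by apply: Or31; split; [case: A01 | exact: r0].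
  have [A1x|nA1] := pselect (A1 x); last by apply: Or33; split=> //; exact: r1.
  (* Where [g0L] vanishes, both quotients are 0 by the convention for division by 0. *)
  by apply: Or32; split=> //; rewrite A0x A1x.
Qed.
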